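(* For every fixed positive integer $k$, $\beta_{m,k}\in 1-\Omega\!\left(\frac{1}{\sqrt[k]{m}}\right)$ as $m\to\infty$; that is, there is a constant $c_k>0$ such that $\beta_{m,k}\le 1-c_k m^{-1/k}$ for all $m\ge k$.
   Context: For a family of subsets of a set $X$, a hitting set is a subset $Y\subseteq X$ meeting every member of the family. For a positive integer $m$ and $k\in\{1,\dots,m\}$, $\beta_{m,k}$ is the smallest real number $\beta$ such that: for any finite set $X$ and any $m$ subsets $A_1,\dots,A_m$ of $X$ with $|A_i|>\beta|X|$ for all $i$, there is a hitting set for $\{A_1,\dots,A_m\}$ of size at most $k$. *)

(* Defs.v *)
From HB Require Import structures.
From mathcomp Require Import all_boot all_order all_algebra.
From mathcomp Require Import boolp classical_sets reals exp.

Set Implicit Arguments.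
Unset Strict Implicit.
Unset Printing Implicit Defensive.

Import Order.TTheory GRing.Theory Num.Theory.

Local Open Scope classical_set_scope.
Local Open Scope ring_scope.

Definition hitting_set (X I : finType) (A : I -> {set X}) (Y : {set X}) : Prop :=
  forall i, (Y :&: A i)%SET != finset.set0.

(* The sets A_1, ..., A_m need not be distinct. *)
Definition admissible (R : realType) (m k : nat) (b : R) : Prop :=
  forall (X : finType) (A : 'I_m -> {set X}),
    (forall i, b * #|X|%:R < #|A i|%:R) ->
    exists2 Y : {set X}, (#|Y| <= k)%N & hitting_set A Y.

(* For 0 < m, this infimum is attained: see beta_least. *)
Definition beta (R : realType) (m k : nat) : R := inf [set b : R | admissible m k b].

Lemma admissible1 (R : realType) m k : (0 < m)%N -> admissible m k (1 : R).
Proof.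
move=> m0 X A /(_ (Ordinal m0)); rewrite mul1r ltr_nat ltnNge.
by rewrite max_card.
Qed.

Lemma admissible_ge0 (R : realType) m k (b : R) :
  (0 < m)%N -> admissible m k b -> 0 <= b.
Proof.
move=> m0 bP; rewrite leNgt; apply/negP => b0.
have [|Y _ /(_ (Ordinal m0))] := bP unit (fun=> finset.set0).
  by move=> i; rewrite cards0 card_unit mulr1.
by rewrite finset.setI0 eqxx.
Qed.

Lemma beta_least (R : realType) m k : (0 < m)%N ->
  admissible m k (beta R m k) /\
  forall b : R, admissible m k b -> beta R m k <= b.
Proof.
move=> m0; set S := [set b : R | admissible m k b].
have S0 : has_inf S.
  split; first by exists 1; exact: admissible1.
  by exists 0 => b; exact: admissible_ge0.
have lb b : admissible m k b -> beta R m k <= b.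
  by move=> bP; apply: ge_inf => //; case: S0.
split=> // X A AX.
have X0 : 0 < #|X|%:R :> R.
  rewrite ltr0n lt0n; apply/eqP => X0; move: (AX (Ordinal m0)).
  have /eqP -> : (#|A (Ordinal m0)| == 0)%N by rewrite -leqn0 -[leqRHS]X0 max_card.
  by rewrite X0 mulr0 ltxx.
have [i _ imin] := arg_minnP (fun i => #|A i|) (erefl : xpredT (Ordinal m0)).
have e0 : 0 < #|A i|%:R / #|X|%:R - beta R m k :> R.
  by rewrite subr_gt0 ltr_pdivlMr.
have [b bP] := inf_adherent e0 S0.
rewrite -/(beta R m k) addrC subrK ltr_pdivlMr // => bA.
by apply: (bP X A) => j; apply: (lt_le_trans bA); rewrite ler_nat imin.
Qed.

(* Main.v *)
Require Import Defs.
From HB Require Import structures.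
From mathcomp Require Import all_boot all_order all_algebra.
From mathcomp Require Import boolp classical_sets reals exp.

Set Implicit Arguments.
Unset Strict Implicit.
Unset Printing Implicit Defensive.

Import Order.TTheory GRing.Theory Num.Theory.

Local Open Scope ring_scope.

(** Draw [k] points of [X] independently and uniformly. If every complement of
    an [A i] has density less than [m^(-1/k)], the [k] points all miss a given
    [A i] with probability less than [1/m], so by the union bound some choice
    of [k] points misses none of the [m] sets. The constant is [c = 1]. *)

(** The union bound as a count of [k]-tuples: exactly [#|~: A i| ^ k] of them avoid [A i], so some
    tuple avoids none of the sets. *)
Lemma hitting_set_sum_exp (X I : finType) (A : I -> {set X}) (k : nat) :
  (\sum_i #|~: A i| ^ k < #|X| ^ k)%N ->
  exists2 Y : {set X}, (#|Y| <= k)%N & hitting_set A Y.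
Proof.
move=> ltAX.
pose missing i := [set f : {ffun 'I_k -> X} | f \in ffun_on (mem (~: A i))]%SET.
have cardmissing i : #|missing i| = (#|~: A i| ^ k)%N.
  by rewrite cardsE card_ffun_on card_ord.
have : (#|\bigcup_i missing i| < #|{: {ffun 'I_k -> X}}|)%N.
  rewrite card_ffun card_ord; apply: leq_ltn_trans ltAX.
  elim/big_ind2: _ => [|B a C b leBa leCb|i _]; first by rewrite cards0.
  - by rewrite (leq_trans (leq_card_setU _ _)) // leq_add.
  - by rewrite cardmissing.
rewrite ltnNge => /negP lt_card.
have [f fP] : exists f, f \notin (\bigcup_i missing i)%SET.
  apply/existsP; rewrite -negb_forall; apply/negP => /forallP all_missing.
  by apply: lt_card; apply: subset_leq_card; apply/fintype.subsetP => f _.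
(* The entries of [f] may repeat, so the image has at most [k] points. *)
exists [set f j | j in 'I_k]%SET.
  by rewrite (leq_trans (leq_imset_card _ _)) // card_ord.
move=> i; apply/negP => /eqP YA0; move/negP: fP; apply.
apply/bigcupP; exists i => //; rewrite inE; apply/ffun_onP => j.
rewrite inE; apply/negP => fjA.
have : f j \in ([set f j | j in 'I_k] :&: A i)%SET by rewrite inE fjA imset_f.
by rewrite YA0 inE.
Qed.

(** Each complement has density strictly below [e]. This strictness survives the power and the sum,
    so the borderline case [m * e ^ k = 1] is covered. *)
Lemma admissible_subr1 (R : realType) (m k : nat) (e : R) :
  (0 < m)%N -> (0 < k)%N -> 0 <= e -> m%:R * e ^+ k <= 1 ->
  admissible m k (1 - e).
Proof.
move=> m0 k0 e0 mek X A AX; apply: hitting_set_sum_exp.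
rewrite -(ltr_nat R) natr_sum natrX.
have ltAc i : #|~: A i|%:R ^+ k < (e * #|X|%:R) ^+ k :> R.
  rewrite ltr_pXn2r ?nnegrE ?mulr_ge0 //.
  have := AX i; rewrite -(cardsC (A i)) natrD mulrBl mul1r.
  by rewrite ltrBlDr ltrD2l.
apply: (@lt_le_trans _ _ (\sum_(i < m) (e * #|X|%:R) ^+ k)).
  (* Summation keeps the inequality strict because [m0] provides an index. *)
  rewrite ltr_sum //; last by move=> i _; rewrite natrX.
  by apply/hasP; exists (Ordinal m0); rewrite ?mem_index_enum.
rewrite sumr_const card_ord -[_ *+ m]mulr_natl exprMn mulrA.
by rewrite ler_piMl // exprn_ge0.
Qed.

Theorem theorem6 (R : realType) (k : nat) (hk : (0 < k)%N) :
  exists2 c : R, 0 < c &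
    forall m : nat, (k <= m)%N -> beta R m k <= 1 - c * m%:R `^ (- k%:R^-1).
Proof.
exists 1 => // m km; rewrite mul1r.
have m0 : (0 < m)%N := leq_trans hk km.
have [_ beta_le] := @beta_least R m k m0.
apply/beta_le/admissible_subr1; rewrite ?powR_ge0 //.
(* For [e = m^(-1/k)] the power [e ^ k] is [m^(-1)], so the bound holds with equality. *)
rewrite -powR_mulrn ?powR_ge0 // -powRrM mulNr mulVf ?pnatr_eq0 -?lt0n //.
by rewrite powR_inv1 // divff // pnatr_eq0 -lt0n.
Qed.
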